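(* Let $\mathcal{A}$ be an arbitrary (not necessarily unital) C*-algebra, let $E, F, G$ be Hilbert $\mathcal{A}$-modules, and let $S \in \mathcal{L}(E,F)$ and $T \in \mathcal{L}(F,G)$ be bounded adjointable operators with closed range. Then the following three conditions are equivalent: (i) $TS$ has closed range; (ii) $Ker(T)+Ran(S)$ is an orthogonal summand in $F$; (iii) $Ker(S^* )+Ran(T^* )$ is an orthogonal summand in $F$. Furthermore, if $c_0\big(Ran(S),\, Ker(T) \cap [Ker(T) \cap Ran(S)]^{\perp}\big) < 1$ and $\overline{Ker(S^* )+Ran(T^* )}$ is an orthogonal summand in $F$, then $TS$ has closed range.
   Context: Hilbert $\mathcal{A}$-modules are left modules with an $\mathcal{A}$-valued inner product, $\mathcal{A}$-linear in the first variable, complete for the norm $\|x\| = \|\langle x,x\rangle\|^{1/2}$. $\mathcal{L}(E,F)$ is the set of bounded adjointable operators $T:E\to F$, i.e. bounded $\mathcal{A}$-linear maps for which there is $T^*:F\to E$ with $\langle Tx,y\rangle=\langle x,T^*y\rangle$ for all $x\in E$, $y\in F$. $Ker$ and $Ran$ denote kernel and range. For a submodule $M$ of $F$, $M^\perp=\{y\in F:\langle x,y\rangle=0 \text{ for all } x\in M\}$, and $M$ is called an orthogonal summand in $F$ if $M$ is closed and $F=M\oplus M^\perp$. Overline denotes norm closure. For submodules $M,N$ of a Hilbert C*-module, $$c_0(M,N)=\sup\{\|\langle x,y\rangle\| : x\in M,\ \|x\|\le 1,\ y\in N,\ \|y\|\le 1\},$$ the cosine of the Dixmier (minimal) angle $\alpha_0(M,N)\in[0,\pi/2]$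 between $M$ and $N$. *)

(* Defs.v *)
From HB Require Import structures.
From mathcomp Require Import all_boot all_order all_algebra.
From mathcomp Require Import complex.
From mathcomp Require Import all_classical all_reals all_analysis.
Set Implicit Arguments.
Unset Strict Implicit.
Unset Printing Implicit Defensive.
Import Order.TTheory GRing.Theory Num.Theory.
Import numFieldNormedType.Exports.
Local Open Scope classical_set_scope.
Local Open Scope ring_scope.

(* The product is a new operation because the MathComp ring structures all
   have a unit. Norms over R[i] take their (real, nonnegative) values in R[i]. *)
HB.mixin Record CompleteNormedModule_isCStarAlgebra (R : realType) A
    of CompleteNormedModule R[i] A := {
  cmul : A -> A -> A;
  cstar : A -> A;
  cmulA : associative cmul;
  cmulDl : left_distributive cmul +%R;
  cmulDr : right_distributive cmul +%R;
  cmulZl : forall (l : R[i]) (a b : A), cmul (l *: a) b = l *: cmul a b;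
  cmulZr : forall (l : R[i]) (a b : A), cmul a (l *: b) = l *: cmul a b;
  cstarK : involutive cstar;
  cstarD : {morph cstar : a b / a + b};
  cstarZ : forall (l : R[i]) (a : A), cstar (l *: a) = l^* *: cstar a;
  cstarM : forall a b : A, cstar (cmul a b) = cmul (cstar b) (cstar a);
  ler_norm_cmul : forall a b : A, `|cmul a b| <= `|a| * `|b|;
  norm_cstar_cmul : forall a : A, `|cmul (cstar a) a| = `|a| ^+ 2
}.

#[short(type="cStarAlgType")]
HB.structure Definition CStarAlgebra (R : realType) :=
  {A of CompleteNormedModule R[i] A & CompleteNormedModule_isCStarAlgebra R A}.

Definition cpositive (R : realType) (A : cStarAlgType R) (a : A) : Prop :=
  exists b : A, a = cmul (cstar b) b.

(* [norm_ip] makes the norm of the underlying Banach space the one induced by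
   the inner product, so that E is complete for it. *)
HB.mixin Record CompleteNormedModule_isHilbertModule (R : realType)
    (A : cStarAlgType R) E of CompleteNormedModule R[i] E := {
  act : A -> E -> E;
  ip : E -> E -> A;
  actM : forall (a b : A) (x : E), act (cmul a b) x = act a (act b x);
  actDl : forall (a b : A) (x : E), act (a + b) x = act a x + act b x;
  actDr : forall (a : A) (x y : E), act a (x + y) = act a x + act a y;
  actZl : forall (l : R[i]) (a : A) (x : E), act (l *: a) x = l *: act a x;
  actZr : forall (l : R[i]) (a : A) (x : E), act a (l *: x) = l *: act a x;
  ipDl : forall x y z : E, ip (x + y) z = ip x z + ip y z;
  ipZl : forall (l : R[i]) (x y : E), ip (l *: x) y = l *: ip x y;
  ip_act : forall (a : A) (x y : E), ip (act a x) y = cmul a (ip x y);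
  ip_star : forall x y : E, cstar (ip x y) = ip y x;
  ip_ge0 : forall x : E, cpositive (ip x x);
  ip_eq0 : forall x : E, ip x x = 0 -> x = 0;
  norm_ip : forall x : E, `|x| ^+ 2 = `|ip x x|
}.

#[short(type="hilbertModType")]
HB.structure Definition HilbertModule (R : realType) (A : cStarAlgType R) :=
  {E of CompleteNormedModule R[i] E & CompleteNormedModule_isHilbertModule R A E}.

Arguments act {R A E} a x : rename.
Arguments ip {R A E} x y : rename.

(* [adj] is determined by [op], the inner product of E being definite. *)
Record adjointable (R : realType) (A : cStarAlgType R)
    (E F : hilbertModType A) := Adjointable {
  op :> {linear E -> F};
  adj : F -> E;
  op_act : forall (a : A) (x : E), op (act a x) = act a (op x);
  op_bounded : exists k : R[i], forall x : E, `|op x| <= k * `|x|;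
  adjP : forall (x : E) (y : F), ip (op x) y = ip x (adj y)
}.

Section Submodules.
Variables (R : realType) (A : cStarAlgType R).

Definition ker (E F : hilbertModType A) (f : E -> F) : set E :=
  [set x | f x = 0].

Variable F : hilbertModType A.
Implicit Types M N : set F.

(* The library's notation A `+` B is the symmetric difference. *)
Definition sumset M N : set F := [set x + y | x in M & y in N].

Definition orth M : set F := [set y | forall x, M x -> ip x y = 0].

Definition orthogonal_summand M : Prop :=
  [/\ closed M, sumset M (orth M) = setT & M `&` orth M = [set 0]].

(* The norms below lie in R[i] and are real: [complex.Re] only changes their
   type. *)
Definition c0 M N : R :=
  sup [set r : R | exists x y : F,
    [/\ M x, `|x| <= 1, N y, `|y| <= 1 & r = complex.Re `|ip x y|]].

End Submodules.

(* Main.v *)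
(* If f has an adjoint g and closed range, then <f x, y> = <x, g y> and a
   gliding hump show that g is bounded below on the range W of f, hence so is
   the self-adjoint f g on W. For real t, (f g + it) y and (f g - it) y have the
   same norm, so the triangle inequality bounds f g + it below on W uniformly in
   t, and the method of continuity makes f g onto W. Hence
   F = ran f + ker g, E = ran g + ker f, and ran g is closed. Positivity in the
   C*-algebra is never needed: the triangle inequality of the module norm gives
   the Cauchy-Schwarz inequality with constant 4 and |x| <= |x + y| for
   orthogonal x, y.
   Since Ker T + Ran S is the preimage of Ran TS under T, one is closed iff the
   other is; when closed, the sum is Ker T + Ran qS for q the projection onto
   Ran T*, an orthogonal sum of two summands. Condition (iii) is (ii) for
   S* T* = (TS)*.
   In the last part, K = Ker T /\ Ran S is the orthogonal complement of the
   closure of Ker S* + Ran T*, so Ker T = K + N with N = Ker T /\ K^perp, and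
   Ker T + Ran S = N + Ran S. With p the projection onto Ran S and c the cosine,
   |y - p y| >= (1 - c)|y| on N, so N + Ran S is closed. *)
Require Import Defs.
From HB Require Import structures.
From mathcomp Require Import all_boot all_order all_algebra.
From mathcomp Require Import complex ring lra.
From mathcomp Require Import all_classical all_reals all_analysis.
Set Implicit Arguments.
Unset Strict Implicit.
Unset Printing Implicit Defensive.
Import Order.TTheory GRing.Theory Num.Theory.
Import numFieldNormedType.Exports.
Local Open Scope classical_set_scope.
Local Open Scope ring_scope.

(** * Real-valued norms and geometric convergence *)

Section RealNorm.
Variable R : realType.

(** The norm itself lies in [R[i]], which is only partially ordered; this copy in [R] admits real
    linear arithmetic. *)
Definition nrm (V : normedModType R[i]) (x : V) : R := complex.Re `|x|.

Lemma nrmE (V : normedModType R[i]) (x : V) : `|x| = (nrm x)%:C%C.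
Proof. by rewrite /nrm RRe_real// normr_real. Qed.

Section NormedModule.
Variable V : normedModType R[i].
Implicit Types x y z : V.

Lemma nrm_ge0 x : 0 <= nrm x.
Proof. by have := normr_ge0 x; rewrite nrmE lecR. Qed.

Lemma nrm0 : nrm (0 : V) = 0.
Proof. by rewrite /nrm normr0. Qed.

Lemma nrm_eq0 x : nrm x = 0 -> x = 0.
Proof. by move=> x0; apply/eqP; rewrite -normr_eq0 nrmE x0. Qed.

Lemma nrm_gt0 x : x <> 0 -> 0 < nrm x.
Proof.
move=> x0; rewrite lt_neqAle nrm_ge0 andbT eq_sym.
by apply/eqP => /nrm_eq0.
Qed.

Lemma nrmN x : nrm (- x) = nrm x.
Proof. by rewrite /nrm normrN. Qed.

Lemma nrmD x y : nrm (x + y) <= nrm x + nrm y.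
Proof. by have := ler_normD x y; rewrite !nrmE -rmorphD lecR. Qed.

Lemma nrmB x y : nrm (x - y) <= nrm x + nrm y.
Proof. by rewrite -(nrmN y) nrmD. Qed.

Lemma nrm_distC x y : nrm (x - y) = nrm (y - x).
Proof. by rewrite -nrmN opprB. Qed.

Lemma nrm_distD z x y : nrm (x - y) <= nrm (x - z) + nrm (z - y).
Proof. by apply: le_trans (nrmD _ _); rewrite addrA subrK. Qed.

Lemma nrmZ (t : R) x : 0 <= t -> nrm (t%:C%C *: x) = t * nrm x.
Proof.
move=> t0; rewrite {1}/nrm normrZ ger0_norm; last by rewrite lecR.
by rewrite nrmE -rmorphM.
Qed.

Lemma nrmZi x : nrm ('i *: x) = nrm x.
Proof. by rewrite /nrm normrZ normCi mul1r. Qed.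

Lemma closureP (M : set V) x :
  closure M x <-> forall e : R, 0 < e -> exists2 y, M y & nrm (y - x) < e.
Proof.
split=> [cMx e e0|cMx B].
  have /cMx[y [My xy]] : nbhs x (ball x e%:C%C) by apply: nbhsx_ballx; rewrite ltcR.
  exists y => //; move: xy; rewrite -ball_normE /= distrC nrmE.
  by rewrite ltcR.
case/nbhs_ballP => e /= e0 eB.
have eE : e = (complex.Re e)%:C%C by rewrite RRe_real// gtr0_real.
have [|y My yx] := cMx (complex.Re e); first by rewrite -ltcR -eE.
by exists y; split=> //; apply: eB; rewrite -ball_normE /= distrC nrmE eE ltcR.
Qed.

Lemma closedP (M : set V) :
  (forall x, (forall e : R, 0 < e -> exists2 y, M y & nrm (y - x) < e) -> M x) <->
  closed M.
Proof. by split=> cM x => [/closureP/cM//|/closureP /cM]. Qed.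

End NormedModule.

Lemma expr_small (q C : R) : 0 < q < 1 -> 0 < C ->
  forall e : R, 0 < e -> exists N, C * q ^+ N < e.
Proof.
move=> /andP[q0 q1] C0 e e0.
have /cvgrPdist_lt/(_ (e / C)) : (fun n => q ^+ n) @ \oo --> (0 : R).
  by apply: cvg_expr; rewrite ger0_norm// ltW.
case=> [|N _ /(_ N (leqnn N))] /=; first by rewrite divr_gt0.
by rewrite sub0r normrN ger0_norm ?exprn_ge0 ?ltW// ltr_pdivlMr// mulrC; exists N.
Qed.

Lemma geometric_cvg (V : completeNormedModType R[i]) (u : nat -> V) (C q : R) :
  0 < q < 1 -> (forall n, nrm (u n.+1 - u n) <= C * q ^+ n) ->
  exists l, forall n, nrm (l - u n) <= C * q ^+ n / (1 - q).
Proof.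
move=> q01 uC; have /andP[q0 q1] := q01; have q1' : 0 < 1 - q by lra.
have C0 : 0 <= C by have := le_trans (nrm_ge0 _) (uC 0); rewrite expr0 mulr1.
(* The exact sum of the [k] step bounds from [n] on, a form that closes under induction. *)
have dist n k : nrm (u (n + k)%N - u n) <= C * q ^+ n / (1 - q) * (1 - q ^+ k).
  elim: k => [|k IH]; first by rewrite addn0 subrr nrm0 expr0; lra.
  apply: le_trans (nrm_distD (u (n + k)%N) _ _) _.
  have := lerD (uC (n + k)%N) IH; rewrite addnS; move/le_trans; apply.
  by rewrite exprD exprS le_eqVlt; apply/orP; left; apply/eqP; field; lra.
have dist' n k : nrm (u (n + k)%N - u n) <= C * q ^+ n / (1 - q).
  apply: le_trans (dist n k) _; rewrite ler_piMr//.
    by rewrite divr_ge0 ?mulr_ge0 ?exprn_ge0// ltW.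
  by rewrite gerBl exprn_ge0// ltW.
have small e : 0 < e -> exists N, C * q ^+ N / (1 - q) < e.
  move=> e0; have [//||N HN] := @expr_small q (C + 1) q01 _ (e * (1 - q)).
  - lra.
  - by rewrite mulr_gt0.
  exists N; rewrite ltr_pdivrMr//; apply: le_lt_trans HN.
  by rewrite ler_wpM2r// ?exprn_ge0 ?ltW//; lra.
have /cauchy_cvg cu : cauchy (u @ \oo).
  apply: cauchy_exP => e e0.
  have eE : e = (complex.Re e)%:C%C by rewrite RRe_real// gtr0_real.
  have [|N HN] := small (complex.Re e); first by rewrite -ltcR -eE.
  exists (u N); exists N => //= n /= /subnKC <-.
  rewrite -ball_normE /= distrC nrmE eE ltcR.
  exact: le_lt_trans (dist' _ _) HN.
have /cvg_ex[/= l ul] := cu.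
exists l => n; apply/ler_addgt0Pr => e e0.
have /cvgrPdist_lt/(_ e%:C%C) := ul.
case=> [|N _ /(_ (n + N)%N (leq_addl _ _))] /=; first by rewrite ltcR.
rewrite nrmE ltcR => ln; apply: le_trans (nrm_distD (u (n + N)%N) _ _) _.
by rewrite addrC lerD// ltW.
Qed.

End RealNorm.

Lemma le_expr_le0 (R : realType) (q a C : R) : 0 < q < 1 ->
  (forall n, a <= C * q ^+ n) -> a <= 0.
Proof.
move=> q01 aC; apply/ler_addgt0Pr => e e0; rewrite add0r.
have q0 : 0 < q by case/andP: q01.
have [|N HN] := @expr_small _ q (`|C| + 1) q01 _ e e0.
  by have := normr_ge0 C; lra.
apply: le_trans (aC N) _; apply: le_trans (ltW HN).
by rewrite ler_wpM2r// ?exprn_ge0 ?ltW//; have := ler_norm C; lra.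
Qed.

Lemma le_of_sqr_le (R : realType) (a b : R) :
  0 <= a -> 0 <= b -> a ^+ 2 <= a * b -> a <= b.
Proof.
move=> a0 b0; have [->//|an0] := eqVneq a 0.
by rewrite expr2 ler_pM2l// lt_neqAle eq_sym an0.
Qed.

(** * Linear subsets and solving equations by successive approximation *)

Section Subspaces.
Variables (R : realType) (V : completeNormedModType R[i]).

Definition linear_set (M : set V) : Prop :=
  [/\ M 0, forall x y, M x -> M y -> M (x + y)
    & forall (l : R[i]) x, M x -> M (l *: x)].

Lemma linear_setB (M : set V) x y : linear_set M -> M x -> M y -> M (x - y).
Proof. by move=> [_ MD MZ] Mx My; rewrite -scaleN1r; apply: MD => //; exact: MZ. Qed.

Lemma linear_setI (M N : set V) :
  linear_set M -> linear_set N -> linear_set (M `&` N).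
Proof.
move=> [M0 MD MZ] [N0 ND NZ]; split=> //.
- by move=> x y [Mx Nx] [My Ny]; split; [exact: MD|exact: ND].
- by move=> l x [Mx Nx]; split; [exact: MZ|exact: NZ].
Qed.

(* Each approximate solution halves the residual; the corrections form a
   geometric series because B is bounded below. *)
Lemma surj_of_approx (W : set V) (B : V -> V) (d K : R) :
  closed W -> linear_set W -> zmod_morphism B -> (forall x, W x -> W (B x)) ->
  0 < d -> (forall x, W x -> d * nrm x <= nrm (B x)) ->
  0 <= K -> (forall x, nrm (B x) <= K * nrm x) ->
  (forall w, W w -> exists2 y, W y & nrm (B y - w) <= 2^-1 * nrm w) ->
  forall w, W w -> exists2 y, W y & B y = w.
Proof.
move=> /closedP cW sW BB WB d0 Bd K0 BK approx w Ww.
have [W0 WD _] := sW.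
pose Badd := GRing.isZmodMorphism.Build V V B BB.
pose B' : {additive V -> V} := HB.pack B Badd.
have B0 : B 0 = 0 by exact: (raddf0 B').
have BD : {morph B : x y / x + y} by exact: (raddfD B').
have half01 : 0 < (2^-1 : R) < 1 by lra.
have /choice[h hP] : forall w, exists y, W w -> W y /\ nrm (B y - w) <= 2^-1 * nrm w.
  move=> v; have [/approx[y Wy yv]|nWv] := pselect (W v); last by exists 0.
  by exists y.
pose res n := iter n (fun v => v - B (h v)) w.
have Wres n : W (res n).
  by elim: n => [//|n IH] /=; apply: linear_setB => //; apply: WB; case: (hP _ IH).
have res_le n : nrm (res n) <= nrm w * 2^-1 ^+ n.
  elim: n => [|n IH] /=; first by rewrite expr0 mulr1.
  rewrite nrm_distC; have [_ /le_trans] := hP _ (Wres n); apply.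
  by rewrite exprS; lra.
pose u n := \sum_(i < n) h (res i).
have uS n : u n.+1 - u n = h (res n) by rewrite /u big_ord_recr/= addrAC subrr add0r.
have Wu n : W (u n).
  elim: n => [|n IH]; first by rewrite /u big_ord0.
  by rewrite -(subrK (u n) (u n.+1)) uS; apply: WD => //; case: (hP _ (Wres n)).
have Bu n : B (u n) = w - res n.
  elim: n => [|n IH]; first by rewrite /u big_ord0 B0 subrr.
  by rewrite /u big_ord_recr BD/= -/(u n) IH/= opprB addrA addrAC.
have h_le n : nrm (u n.+1 - u n) <= (3 / 2 / d * nrm w) * 2^-1 ^+ n.
  rewrite uS; have [Wh hn] := hP _ (Wres n).
  (* The correction maps to within half of the residual, so its image has norm at most 1 + 1/2 times
     that residual; dividing by [d] bounds the correction. *)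
  have Bh : nrm (B (h (res n))) <= 3 / 2 * nrm (res n).
    have := nrmD (B (h (res n)) - res n) (res n); rewrite subrK; lra.
  have -> : 3 / 2 / d * nrm w * 2^-1 ^+ n = (3 / 2 * (nrm w * 2^-1 ^+ n)) / d by ring.
  rewrite ler_pdivlMr// mulrC; apply: le_trans (Bd _ Wh) _; apply: le_trans Bh _.
  by rewrite ler_wpM2l.
have [l lu] := geometric_cvg half01 h_le.
have C0 : 0 <= 3 / 2 / d * nrm w.
  by rewrite mulr_ge0 ?nrm_ge0 ?divr_ge0// ltW.
move: (3 / 2 / d * nrm w) => C in lu C0.
exists l.
  apply: cW => e e0.
  have [|N HN] := @expr_small _ _ (2 * (C + 1)) half01 _ e e0; first by lra.
  exists (u N) => //; rewrite nrm_distC; apply: le_lt_trans (lu N) _.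
  apply: le_lt_trans HN; rewrite mulrAC ler_wpM2r ?exprn_ge0//.
  have -> : (1 - 2^-1 : R)^-1 = 2 by field.
  lra.
(* [B l - w = B (l - u n) - res n], and both terms decay like [2^-n]. *)
apply/eqP; rewrite -subr_eq0; apply/eqP/nrm_eq0/le_anti; rewrite nrm_ge0 andbT.
apply: (@le_expr_le0 _ _ _ (K * C * 2 + nrm w) half01) => n.
apply: le_trans (nrm_distD (B (u n)) _ _) _.
rewrite -BB Bu addrAC subrr add0r nrmN mulrDl; apply: lerD => //.
apply: le_trans (BK _) _.
apply: le_trans (ler_wpM2l K0 (lu n)) _.
have -> : (1 - 2^-1 : R)^-1 = 2 by field.
by rewrite le_eqVlt; apply/orP; left; apply/eqP; ring.
Qed.

End Subspaces.

(** * Inner products, polarization and orthogonality *)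

Section InnerProduct.
Variables (R : realType) (A : cStarAlgType R).

Lemma cstar0 : cstar (0 : A) = 0.
Proof. by rewrite -(scale0r (0 : A)) cstarZ rmorph0 !scale0r. Qed.

Section OneModule.
Variable E : hilbertModType A.
Implicit Types x y z : E.

Lemma nrm_ip x : nrm (ip x x) = nrm x ^+ 2.
Proof. by rewrite {1}/nrm -norm_ip nrmE -rmorphXn. Qed.

Lemma ip0l x : ip (0 : E) x = 0.
Proof. by rewrite -(scale0r (0 : E)) ipZl scale0r. Qed.

Lemma ip0r x : ip x (0 : E) = 0.
Proof. by rewrite -ip_star ip0l cstar0. Qed.

Lemma ip_eq0C x y : ip x y = 0 -> ip y x = 0.
Proof. by move=> xy; rewrite -ip_star xy cstar0. Qed.

Lemma ipDr x y z : ip x (y + z) = ip x y + ip x z.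
Proof. by rewrite -ip_star ipDl cstarD !ip_star. Qed.

Lemma ipZr (l : R[i]) x y : ip x (l *: y) = l^* *: ip x y.
Proof. by rewrite -ip_star ipZl cstarZ ip_star. Qed.

Lemma ipNl x y : ip (- x) y = - ip x y.
Proof. by rewrite -scaleN1r ipZl scaleN1r. Qed.

Lemma ipNr x y : ip x (- y) = - ip x y.
Proof. by rewrite -ip_star ipNl -scaleN1r cstarZ rmorphN1 scaleN1r ip_star. Qed.

Lemma ipBl x y z : ip (x - y) z = ip x z - ip y z.
Proof. by rewrite ipDl ipNl. Qed.

Lemma ipBr x y z : ip x (y - z) = ip x y - ip x z.
Proof. by rewrite ipDr ipNr. Qed.

Lemma ip_injr x y : (forall z, ip z x = ip z y) -> x = y.
Proof.
by move=> xy; apply/eqP; rewrite -subr_eq0; apply/eqP/ip_eq0; rewrite ipBr xy subrr.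
Qed.

Lemma eq_nrm_of_ip x y : ip x x = ip y y -> nrm x = nrm y.
Proof.
move=> xy; apply/eqP; rewrite -(@eqrXn2 _ 2) ?nrm_ge0//.
by rewrite -!nrm_ip xy.
Qed.

(* x + y and x - y have the same norm, and x is their midpoint. *)
Lemma pythagoras_le x y : ip x y + ip y x = 0 -> nrm x <= nrm (x + y).
Proof.
move=> xy0; have xy : nrm (x - y) = nrm (x + y).
  apply: eq_nrm_of_ip; rewrite ipBl !ipBr !ipDl !ipDr.
  have -> : ip y x = - ip x y by apply/eqP; rewrite -addr_eq0 addrC; apply/eqP.
  by rewrite opprD !opprK !addrA subrK addrK.
have : nrm (2%:C%C *: x) <= nrm (x + y) + nrm (x - y).
  apply: le_trans (nrmD _ _); rewrite addrACA subrr addr0.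
  by rewrite rmorphD/= rmorph1 scalerDl !scale1r.
by rewrite nrmZ// xy; lra.
Qed.

Lemma pythagoras_orth x y : ip x y = 0 -> nrm x <= nrm (x + y).
Proof. by move=> xy; apply: pythagoras_le; rewrite (ip_eq0C xy) xy addr0. Qed.

(** Polarization: twice the symmetric part is [<x + y, x + y> - <x - y, x - y>], and each term has
    norm at most 4. *)
Lemma nrm_ip_sym_le x y : nrm x <= 1 -> nrm y <= 1 -> nrm (ip x y + ip y x) <= 4.
Proof.
move=> x1 y1.
have e : 2%:C%C *: (ip x y + ip y x) = ip (x + y) (x + y) - ip (x - y) (x - y).
  have -> : ip (x + y) (x + y) = (ip x y + ip y x) + (ip x x + ip y y).
    by rewrite ipDl !ipDr [RHS]addrACA [ip x y + _]addrC.
  have -> : ip (x - y) (x - y) = (ip x x + ip y y) - (ip x y + ip y x).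
    by rewrite ipBl !ipBr opprB addrACA -opprD.
  by rewrite rmorphD/= rmorph1 scalerDl !scale1r opprB [RHS]addrACA subrr addr0.
have : nrm (2%:C%C *: (ip x y + ip y x)) <= 8.
  rewrite e; apply: le_trans (nrmB _ _) _; rewrite !nrm_ip.
  have := nrmD x y; have := nrmB x y; have := nrm_ge0 (x + y); have := nrm_ge0 (x - y).
  nra.
by rewrite nrmZ//; lra.
Qed.

(** Replacing [y] by ['i *: y] turns the symmetric part into the skew one; together they recover
    [2 <x, y>]. *)
Lemma nrm_ip_le4 x y : nrm x <= 1 -> nrm y <= 1 -> nrm (ip x y) <= 4.
Proof.
move=> x1 y1.
have e : 2%:C%C *: ip x y = (ip x y + ip y x) + 'i *: (ip x ('i *: y) + ip ('i *: y) x).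
  rewrite rmorphD/= rmorph1 scalerDl !scale1r ipZr ipZl scalerDr !scalerA.
  rewrite conjCi mulrN -expr2 sqrCi opprK scale1r scaleN1r.
  by rewrite addrACA subrr addr0.
have : nrm (2%:C%C *: ip x y) <= 8.
  rewrite e; apply: le_trans (nrmD _ _) _; rewrite nrmZi.
  have y1' : nrm ('i *: y) <= 1 by rewrite nrmZi.
  by have := nrm_ip_sym_le x1 y1; have := nrm_ip_sym_le x1 y1'; lra.
by rewrite nrmZ//; lra.
Qed.

Lemma nrm_ip_le x y : nrm (ip x y) <= 4 * nrm x * nrm y.
Proof.
have [x0|/eqP x0] := eqVneq x 0; first by rewrite x0 ip0l !nrm0 mulr0 mul0r.
have [y0|/eqP y0] := eqVneq y 0; first by rewrite y0 ip0r !nrm0 mulr0.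
have {}x0 := nrm_gt0 x0; have {}y0 := nrm_gt0 y0.
pose a := (nrm x)^-1; pose b := (nrm y)^-1.
have a0 : 0 <= a by rewrite invr_ge0 ltW.
have b0 : 0 <= b by rewrite invr_ge0 ltW.
have := @nrm_ip_le4 (a%:C%C *: x) (b%:C%C *: y).
rewrite !nrmZ// /a /b !mulVf ?gt_eqF// => /(_ (lexx _) (lexx _)).
rewrite ipZl ipZr conj_Creal ?ger0_real ?lecR// !nrmZ//.
by rewrite mulrA -invfM ler_pdivrMl ?mulr_gt0// => /le_trans; apply; rewrite le_eqVlt; apply/orP; left; apply/eqP; ring.
Qed.

Lemma orth_linear (M : set E) : linear_set (orth M).
Proof.
split=> [x _|x y Mx My z Mz|l x Mx z Mz] /=; first by rewrite ip0r.
- by rewrite ipDr Mx// My// addr0.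
- by rewrite ipZr Mx// scaler0.
Qed.

Lemma ip_closure (M : set E) y : (forall x, M x -> ip x y = 0) ->
  forall x, closure M x -> ip x y = 0.
Proof.
move=> My x /closureP cMx; apply: nrm_eq0; apply/le_anti; rewrite nrm_ge0 andbT.
apply/ler_addgt0Pr => e e0; rewrite add0r.
have y0 := nrm_ge0 y.
(* The [+ 1] keeps the denominator positive when [y] is zero. *)
have [|z Mz zx] := cMx (e / (4 * (nrm y + 1))).
  by rewrite divr_gt0// mulr_gt0//; lra.
have -> : ip x y = - ip (z - x) y by rewrite ipBl (My z Mz) sub0r opprK.
rewrite nrmN; apply: le_trans (nrm_ip_le _ _) _.
move: zx; rewrite ltr_pdivlMr; last by rewrite mulr_gt0//; lra.
have := nrm_ge0 (z - x); nra.
Qed.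

Lemma closed_orth (M : set E) : closed (orth M).
Proof.
move=> y cy x Mx; apply: ip_eq0C; apply: (ip_closure _ cy) => z Oz.
by apply: ip_eq0C; exact: Oz.
Qed.

End OneModule.
End InnerProduct.

(** * Maps with an adjoint, and the lower bound given by closed range *)

Section AdjointPairs.
Variables (R : realType) (A : cStarAlgType R).

(** Stated for bare functions, since linearity of both maps and boundedness of [g] follow; adjoints,
    composites and projections are thus treated alike. *)
Definition adj_pair (E F : hilbertModType A) (f : E -> F) (g : F -> E) : Prop :=
  (forall x y, ip (f x) y = ip x (g y)) /\
  exists2 k : R, 0 <= k & forall x, nrm (f x) <= k * nrm x.

Section Pair.
Variables (E F : hilbertModType A) (f : E -> F) (g : F -> E).
Hypothesis fg : adj_pair f g.

(** [|g y|^2 = |<f (g y), y>| <= 4 k |g y| |y|], whence the bound [4 * k]. *)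
Lemma adj_pairC : adj_pair g f.
Proof.
have [fgP [k k0 fk]] := fg; split=> [y x|].
  by rewrite -ip_star -fgP ip_star.
exists (4 * k); first by lra.
move=> y; apply: le_of_sqr_le; rewrite ?mulr_ge0 ?nrm_ge0//.
rewrite -nrm_ip -fgP; apply: le_trans (nrm_ip_le _ _) _.
have := ler_wpM2r (nrm_ge0 y) (fk (g y)); nra.
Qed.

Lemma adj_pairD x y : f (x + y) = f x + f y.
Proof.
have [gfP _] := adj_pairC.
by apply: ip_injr => z; rewrite -gfP !ipDr -!gfP.
Qed.

Lemma adj_pairZ (l : R[i]) x : f (l *: x) = l *: f x.
Proof.
have [gfP _] := adj_pairC.
by apply: ip_injr => z; rewrite -gfP !ipZr -!gfP.
Qed.

Lemma adj_pairB : zmod_morphism f.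
Proof. by move=> x y; rewrite adj_pairD -scaleN1r adj_pairZ scaleN1r. Qed.

Lemma adj_pair0 : f 0 = 0.
Proof. by rewrite -(subrr 0) adj_pairB subrr. Qed.

Lemma range_linear : linear_set (range f).
Proof.
split; first by exists 0; rewrite // adj_pair0.
- by move=> _ _ [x _ <-] [y _ <-]; exists (x + y); rewrite // adj_pairD.
- by move=> l _ [x _ <-]; exists (l *: x); rewrite // adj_pairZ.
Qed.

Lemma ker_orth_range : ker f = orth (range g).
Proof.
have [gfP _] := adj_pairC.
rewrite /ker /orth; apply/seteqP; split=> [x /= fx0 _ [y _ <-]|x /= xo].
  by rewrite gfP fx0 ip0r.
by apply: ip_injr => z; rewrite ip0r -gfP xo//; exists z.
Qed.

Lemma ker_linear : linear_set (ker f).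
Proof. by rewrite ker_orth_range; exact: orth_linear. Qed.

Lemma ker_closed : closed (ker f).
Proof. by rewrite ker_orth_range; exact: closed_orth. Qed.

Lemma adj_compK y : f (g y) = 0 -> g y = 0.
Proof. by move=> fgy; have [fgP _] := fg; apply: ip_eq0; rewrite -fgP fgy ip0l. Qed.

Lemma adj_pair_comp (G : hilbertModType A) (h : F -> G) (k : G -> F) :
  adj_pair h k -> adj_pair (h \o f) (g \o k).
Proof.
move=> [hk [b b0 hb]]; have [fgP [a a0 fa]] := fg.
split=> [x y|] /=; first by rewrite hk fgP.
exists (b * a); first by rewrite mulr_ge0.
by move=> x /=; apply: le_trans (hb _) _; rewrite -mulrA ler_wpM2l.
Qed.

End Pair.

Section ClosedRange.
Variables (E F : hilbertModType A) (f : E -> F) (g : F -> E).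
Hypothesis fg : adj_pair f g.

(* Gliding hump: otherwise there are unit vectors v_n in the range of f with
   |g v_n| much smaller than 9^-n, and signs such that u = sum +-9^-n v_n
   satisfies |<u, v_n>| >= 9^-n / 2. This contradicts
   <f x, v_n> = <x, g v_n> for u = f x. *)
Lemma adj_bounded_below : closed (range f) ->
  exists2 d : R, 0 < d & forall y, range f y -> d * nrm y <= nrm (g y).
Proof.
move=> cf; apply: contrapT => nd.
have [rf0 rfD rfZ] := range_linear fg.
have [fgP _] := fg.
(* With this ratio the steps after the [n]-th sum to at most [q^n / 8]; times the Cauchy-Schwarz
   constant 4 this is half of [q^n]. *)
pose q : R := 9^-1.
have q0 : 0 < q by rewrite /q; lra.
have q01 : 0 < q < 1 by rewrite /q; lra.
have qn0 n : 0 < q ^+ n by rewrite exprn_gt0.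
(* The divisor [n.+1] makes [g (v n)] negligible against [q^n], which yields the final
   contradiction. *)
have /choice[v vP] : forall n, exists y, [/\ range f y, nrm y = 1 &
    nrm (g y) < q ^+ n / n.+1%:R].
  move=> n; apply: contrapT => nv; apply: nd; exists (q ^+ n / n.+1%:R).
    by rewrite divr_gt0.
  move=> y fy; rewrite leNgt; apply/negP => gy.
  have y0 : 0 < nrm y.
    apply: nrm_gt0 => y0; move: gy; rewrite y0 (adj_pair0 (adj_pairC fg)) nrm0 mulr0.
    by rewrite ltNge nrm_ge0.
  apply: nv; exists ((nrm y)^-1%:C%C *: y); split; first exact: rfZ.
    by rewrite nrmZ ?invr_ge0 ?nrm_ge0// mulVf// gt_eqF.
  rewrite (adj_pairZ (adj_pairC fg)) nrmZ ?invr_ge0 ?nrm_ge0//.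
  by rewrite ltr_pdivrMl// mulrC.
pose step n (u : F) := if q ^+ n <= nrm (ip (u + (q ^+ n)%:C%C *: v n) (v n))
  then u + (q ^+ n)%:C%C *: v n else u - (q ^+ n)%:C%C *: v n.
pose u := fix u n := if n is m.+1 then step m (u m) else 0.
have uS n : u n.+1 = step n (u n) by [].
have nv n : nrm ((q ^+ n)%:C%C *: v n) = q ^+ n.
  by have [_ v1 _] := vP n; rewrite nrmZ ?v1 ?mulr1// ltW.
have u_dist n : nrm (u n.+1 - u n) <= 1 * q ^+ n.
  rewrite uS /step mul1r; case: ifP => _; rewrite addrAC subrr add0r ?nrmN nv//.
have uf n : range f (u n).
  elim: n => [//|n IH]; rewrite uS /step; have [fv _ _] := vP n.
  by case: ifP => _; [apply: rfD|apply: linear_setB (range_linear fg) _ _] => //; apply: rfZ.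
have u_hump n : q ^+ n <= nrm (ip (u n.+1) (v n)).
  (* The two candidates differ by [2 w] with [w = q^n v_n], and [|<2 w, v_n>| = 2 q^n]; if the plus
     sign falls short of [q^n], the minus sign does not. *)
  rewrite uS /step; case: ifP => // /negbT; rewrite -ltNge => hu.
  set w := _ *: v n in hu *.
  have : nrm (2%:C%C *: ip w (v n)) <= nrm (ip (u n + w) (v n)) + nrm (ip (u n - w) (v n)).
    apply: le_trans (nrmB _ _).
    by rewrite -ipBl opprD opprK addrACA subrr add0r ipDl rmorphD/= rmorph1 scalerDl !scale1r.
  rewrite nrmZ// ipZl nrmZ ?nrm_ip; last exact: ltW.
  by have [_ -> _] := vP n; rewrite expr1n mulr1; lra.
have [l lu] := geometric_cvg q01 u_dist.
have [x _ fx] : range f l.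
  move/closedP: cf; apply=> e e0.
  have [|N HN] := @expr_small _ _ 2 q01 _ e e0; first by lra.
  exists (u N) => //; rewrite nrm_distC; apply: le_lt_trans (lu N) _.
  apply: le_lt_trans HN.
  have -> : (1 - q)^-1 = 9 / 8 by rewrite /q; field.
  by have := qn0 N; lra.
have contr n : n.+1%:R <= 8 * nrm x.
  have [_ v1 gv] := vP n.
  have h1 : nrm (ip l (v n)) <= 4 * nrm x * (q ^+ n / n.+1%:R).
    rewrite -fx fgP; apply: le_trans (nrm_ip_le _ _) _.
    by rewrite ler_wpM2l ?mulr_ge0 ?nrm_ge0// ltW.
  have h2 : nrm (ip (u n.+1 - l) (v n)) <= 2^-1 * q ^+ n.
    apply: le_trans (nrm_ip_le _ _) _; rewrite v1 mulr1 nrm_distC.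
    have := lu n.+1; rewrite exprS.
    have -> : (1 - q)^-1 = 9 / 8 by rewrite /q; field.
    by rewrite {1}/q; lra.
  have h3 : q ^+ n <= 2^-1 * q ^+ n + 4 * nrm x * (q ^+ n / n.+1%:R).
    apply: le_trans (u_hump n) _; rewrite -(subrK l (u n.+1)) ipDl.
    by apply: le_trans (nrmD _ _) _; exact: lerD.
  have : q ^+ n * n.+1%:R <= q ^+ n * (8 * nrm x).
    rewrite -ler_pdivlMr//; move: h3; move: (n.+1%:R^-1) (q ^+ n) => t p.
    by move: (nrm x) => a; nra.
  by rewrite ler_pM2l.
have := contr (Num.bound (8 * nrm x)); rewrite leNgt => /negP; apply.
have x0 : 0 <= 8 * nrm x by rewrite mulr_ge0 ?nrm_ge0.
by apply: lt_le_trans (archi_boundP x0) _; rewrite ler_nat.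
Qed.

End ClosedRange.
End AdjointPairs.

(** * Surjectivity of self-adjoint maps bounded below *)

Section SelfAdjoint.
Variables (R : realType) (A : cStarAlgType R) (F : hilbertModType A).
Variables (P : F -> F) (W : set F).
Hypothesis PP : adj_pair P P.
Hypotheses (cW : closed W) (lW : linear_set W) (WP : forall x, W x -> W (P x)).

Let B (t : R) (y : F) : F := P y + t%:C%C *: ('i *: y).

(** [P] is self-adjoint and multiplication by [it] is skew-adjoint, so the cross terms cancel, as
    [pythagoras_le] requires. *)
Let orthPi t y :
  ip (P y) (t%:C%C *: ('i *: y)) + ip (t%:C%C *: ('i *: y)) (P y) = 0.
Proof.
have [PPs _] := PP.
rewrite !ipZr !ipZl -PPs conjCi conj_Creal ?complex_real//.
by rewrite scaleNr scalerN addNr.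
Qed.

Let B_geP t y : nrm (P y) <= nrm (B t y).
Proof. exact: pythagoras_le. Qed.

Let BB t : zmod_morphism (B t).
Proof.
by move=> x y; rewrite /B (adj_pairB PP) !scalerBr opprD addrACA.
Qed.

Let WB t x : W x -> W (B t x).
Proof.
have [_ WD WZ] := lW.
by move=> Wx; apply: WD; [exact: WP|exact: (WZ _ _ (WZ _ _ Wx))].
Qed.

(* P + it is bounded below on W uniformly in t, since
   <(P + it)y, (P + it)y> = <(P - it)y, (P - it)y>. As P + it is onto W for
   large t, steps of fixed length bring t down to 0. *)
Lemma selfadjoint_surj (d : R) :
  0 < d -> (forall y, W y -> d * nrm y <= nrm (P y)) ->
  forall w, W w -> exists2 y, W y & P y = w.
Proof.
move=> d0 Pd.
have [_ [k k0 Pk]] := PP.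
have [_ _ WZ] := lW.
pose surj t := forall w, W w -> exists2 y, W y & B t y = w.
have surjB t : 0 <= t ->
    (forall w, W w -> exists2 y, W y & nrm (B t y - w) <= 2^-1 * nrm w) -> surj t.
  move=> t0; apply: (@surj_of_approx _ _ W (B t) d (k + t)) => //.
  - exact: WB.
  - by move=> y Wy; apply: le_trans (Pd _ Wy) _; exact: B_geP.
  - by rewrite addr_ge0.
  - move=> y; apply: le_trans (nrmD _ _) _.
    by rewrite nrmZ// nrmZi mulrDl lerD.
(* For [y = -i w / t] the term [it y] is exactly [w]; the error [P y] has norm at most [k / t],
   hence at most half, of that of [w]. *)
have surj_large t : 2 * k + 1 <= t -> surj t.
  move=> kt; apply: surjB => [|w Ww]; first by lra.
  have t0 : 0 < t by lra.
  exists (t^-1%:C%C *: (- 'i *: w)); first exact: (WZ _ _ (WZ _ _ Ww)).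
  have -> : B t (t^-1%:C%C *: (- 'i *: w)) - w = P (t^-1%:C%C *: (- 'i *: w)).
    rewrite /B !scalerA; set c : R[i] := (X in _ + X *: w - w).
    suff -> : c = 1 by rewrite scale1r addrK.
    have tt : t%:C%C * t^-1%:C%C = 1 :> R[i] by rewrite -rmorphM/= mulfV ?gt_eqF.
    have ii : 'i * 'i = -1 :> R[i] by rewrite -expr2 sqrCi.
    have -> : c = - ((t%:C%C * t^-1%:C%C) * ('i * 'i)) by rewrite /c; ring.
    by rewrite tt ii mul1r opprK.
  apply: le_trans (Pk _) _; rewrite nrmZ; last by rewrite invr_ge0 ltW.
  rewrite scaleNr nrmN nrmZi.
  rewrite mulrA ler_wpM2r ?nrm_ge0// ler_pdivrMr//; lra.
(* An exact solution [y] at [s] leaves the error [(s - t) |y| <= (d / 2) |y| <= |P y| / 2 <= |w| /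
   2] at [t]. *)
have surj_step s t : 0 <= t -> t <= s -> s - t <= d / 2 -> surj s -> surj t.
  move=> t0 ts st ss; apply: surjB => // w /ss[y Wy yw]; exists y => //.
  have -> : B t y - w = - ((s - t)%:C%C *: ('i *: y)).
    by rewrite -yw /B opprD addrACA subrr add0r rmorphB/= scalerBl opprB.
  rewrite nrmN nrmZ ?subr_ge0// nrmZi -yw.
  have := B_geP s y; have := Pd _ Wy; have := nrm_ge0 y; nra.
have surj_desc n : surj (n%:R * (d / 2)) -> surj 0.
  elim: n => [|n IH]; first by rewrite mul0r.
  move=> Sn; apply: IH; apply: surj_step Sn.
  - by rewrite mulr_ge0// ltW// divr_gt0.
  - by rewrite ler_wpM2r ?ler_nat// ltW// divr_gt0.
  - by rewrite -mulrBl -natrB// subSnn mul1r.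
have S0 : surj 0.
  apply: (@surj_desc (Num.bound ((2 * k + 1) / (d / 2)))); apply: surj_large.
  rewrite -ler_pdivrMr ?divr_gt0// ltW// archi_boundP//.
  by rewrite divr_ge0//; lra.
move=> w /S0[y Wy <-]; exists y => //.
by rewrite /B rmorph0 scale0r addr0.
Qed.

End SelfAdjoint.

(** * Orthogonal decompositions from a closed range *)

Section ClosedRange.
Variables (R : realType) (A : cStarAlgType R) (E F : hilbertModType A).
Variables (f : E -> F) (g : F -> E).
Hypotheses (fg : adj_pair f g) (cf : closed (range f)).

Let gf := adj_pairC fg.

(** On the range of [f], [d^2 |y|^2 <= |g y|^2 = |<f (g y), y>| <= 4 |f (g y)| |y|], so [f \o g] is
    bounded below by [d^2 / 4]. *)
Lemma range_comp_adj w : range f w -> exists2 y, range f y & f (g y) = w.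
Proof.
have [d d0 gd] := adj_bounded_below fg cf.
have fgfg := adj_pair_comp gf fg.
have d4 : 0 < d ^+ 2 / 4 by rewrite divr_gt0// exprn_gt0.
apply: (selfadjoint_surj fgfg cf (range_linear fg) _ d4) => [x _|y fy] /=.
  by exists (g x).
have [->|/eqP/nrm_gt0 y0] := eqVneq y 0; first by rewrite nrm0 mulr0 nrm_ge0.
have [fgP _] := fg.
have h : nrm (g y) ^+ 2 <= 4 * nrm (f (g y)) * nrm y.
  by rewrite -nrm_ip -fgP; exact: nrm_ip_le.
have h2 : (d * nrm y) ^+ 2 <= nrm (g y) ^+ 2.
  by rewrite lerXn2r ?nnegrE ?mulr_ge0 ?nrm_ge0 ?gd// ltW.
rewrite -(ler_pM2r y0); lra.
Qed.

Lemma range_ker_decomp y : exists2 x, range f x & g (y - x) = 0.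
Proof.
have [|x fx xy] := @range_comp_adj (f (g y)); first by exists (g y).
exists x => //; apply: (adj_compK fg).
by rewrite (adj_pairB gf) (adj_pairB fg) xy subrr.
Qed.

Lemma adj_ker_decomp x : exists z, f (x - g z) = 0.
Proof.
have [|z _ xz] := @range_comp_adj (f x); first by exists x.
by exists z; rewrite (adj_pairB fg) xz subrr.
Qed.

(** A limit [x] of the range differs from some [g z] by an element of [ker f], which is orthogonal
    to the closure of the range, hence to itself. *)
Lemma adj_range_closed : closed (range g).
Proof.
move=> x cgx; have [z fz] := adj_ker_decomp x.
suff -> : x = g z by exists z.
apply/eqP; rewrite -subr_eq0; apply/eqP/ip_eq0.
rewrite ipBl; have [gfP _] := gf; rewrite gfP fz ip0r subr0.
by apply: ip_closure cgx => _ [y _ <-]; rewrite gfP fz ip0r.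
Qed.

End ClosedRange.

(** * Projections, sums of submodules and the Dixmier angle *)

Section Summands.
Variables (R : realType) (A : cStarAlgType R).

(** Choose the component in [M]; [<q x, q y> = <q x, y>] makes the choice self-adjoint, and the norm
    bounds come from orthogonality. *)
Lemma exists_proj (F : hilbertModType A) (M : set F) :
  (forall x, exists2 y, M y & orth M (x - y)) ->
  exists2 q : F -> F, adj_pair q q &
    forall x, [/\ M (q x), orth M (x - q x) & nrm (x - q x) <= nrm x].
Proof.
move=> decomp.
have /choice[q qP] : forall x, exists y, M y /\ orth M (x - y).
  by move=> x; have [y My oy] := decomp x; exists y.
have Mq x : M (q x) by have [] := qP x.
have oq x : orth M (x - q x) by have [] := qP x.
exists q; last first.
  move=> x; split=> //; rewrite -[in leRHS](subrK (q x) x).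
  by apply/pythagoras_orth/ip_eq0C; exact: oq.
have qq x y : ip (q x) (q y) = ip (q x) y.
  by apply/esym/eqP; rewrite -subr_eq0 -ipBr; apply/eqP; exact: oq.
split=> [x y|].
  by rewrite -(qq x y) -[RHS]ip_star -(qq y x) ip_star.
exists 1 => // x; rewrite mul1r -[in leRHS](subrK (q x) x) addrC.
by apply: pythagoras_orth; exact: oq.
Qed.

Lemma orth_meet0 (F : hilbertModType A) (M : set F) : M 0 -> M `&` orth M = [set 0].
Proof.
move=> M0; apply/seteqP; split=> [x [Mx /(_ _ Mx)/ip_eq0//]|_ ->].
by split=> // x _; rewrite ip0r.
Qed.

Section Composition.
Variables (E F G : hilbertModType A).
Variables (f : E -> F) (g : F -> E) (h : F -> G) (k : G -> F).
Hypotheses (fg : adj_pair f g) (hk : adj_pair h k).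
Hypotheses (cf : closed (range f)) (ch : closed (range h)).

Let kh := adj_pairC hk.

Lemma closed_sumset_comp :
  closed (range (h \o f)) -> closed (sumset (ker h) (range f)).
Proof.
move=> /closedP chf y /closureP cy.
have [_ [b b0 hb]] := hk.
have [x _ /= hfx] : range (h \o f) (h y).
  apply: chf => e e0.
  have [|_ [u hu [_ [x _ <-] <-]] uy] := cy (e / (b + 1)).
    by rewrite divr_gt0//; lra.
  exists (h (f x)); first by exists x.
  have -> : h (f x) - h y = h (u + f x - y).
    by rewrite (adj_pairB hk) (adj_pairD hk) hu add0r.
  apply: le_lt_trans (hb _) _; move: uy; rewrite ltr_pdivlMr; last by lra.
  by have := nrm_ge0 (u + f x - y); nra.
exists (y - f x); first by rewrite /ker/= (adj_pairB hk) hfx subrr.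
by exists (f x); [exists x|rewrite subrK].
Qed.

(** Moving [f x] along [ker h] into the range of [k] stays in the sum and keeps the image under [h].
    There [h] is bounded below, so convergence of images lifts. *)
Lemma closed_comp_sumset :
  closed (sumset (ker h) (range f)) -> closed (range (h \o f)).
Proof.
move=> /closedP csum z cz.
have ck := adj_range_closed hk ch.
have [d d0 hd] := adj_bounded_below kh ck.
have [w hw kw] : exists2 w, h w = z & range k w.
  have [w _ wz] : range h z.
    move/closedP: (ch); apply=> e e0; have /closureP/(_ _ e0)[_ [x _ <-] xz] := cz.
    by exists (h (f x)) => //; exists (f x).
  have [u] := adj_ker_decomp hk ch w.
  rewrite (adj_pairB hk) => /eqP; rewrite subr_eq0 => /eqP hwu.
  by exists (k u); [rewrite -hwu|exists u].
have [u hu [_ [x _ <-] uw]] : sumset (ker h) (range f) w.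
  apply: csum => e e0.
  have /closureP/(_ (d * e))[|_ [x _ <-] /= xz] := cz; first by rewrite mulr_gt0.
  have [v] := adj_ker_decomp hk ch (f x) => hfv.
  exists (k v).
    exists (- (f x - k v)).
      by rewrite /ker/= -scaleN1r (adj_pairZ hk) hfv scaler0.
    by exists (f x); [exists x|rewrite opprB subrK].
  rewrite -(ltr_pM2l d0); apply: le_lt_trans (hd _ _) _.
    by apply: linear_setB (range_linear kh) _ kw; exists v.
  rewrite (adj_pairB hk) hw; suff -> : h (k v) = h (f x) by [].
  by apply/esym/eqP; rewrite -subr_eq0 -(adj_pairB hk) hfv.
by exists x => //=; rewrite -hw -uw (adj_pairD hk) hu add0r.
Qed.

(* With q the projection onto the range of k = h*, the sum is
   ker h + range (q f), and the two summands are orthogonal. *)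
Lemma sumset_orthogonal_summand :
  closed (sumset (ker h) (range f)) ->
  orthogonal_summand (sumset (ker h) (range f)).
Proof.
move=> csum; have ck := adj_range_closed hk ch.
have [q qq qP] : exists2 q : F -> F, adj_pair q q &
    forall x, [/\ range k (q x), orth (range k) (x - q x) & nrm (x - q x) <= nrm x].
  apply: exists_proj => x; have [z hz] := adj_ker_decomp hk ch x.
  by exists (k z); [exists z|rewrite -(ker_orth_range hk)].
have hq x : ker h (x - q x).
  by rewrite (ker_orth_range hk); have [_ ? _] := qP x.
have [fgP _] := fg; have [khP _] := kh.
(* [q (f x)] differs from [f x] by an element of [ker h], so a limit [v] has the form [a + f x] with
   [a] in [ker h]. Then [v - q (f x)] lies in both the range of [k] and [ker h], hence vanishes. *)
have cqf : closed (range (q \o f)).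
  move=> v cv.
  have [a ha [_ [x _ <-] av]] : sumset (ker h) (range f) v.
    apply: csum; move: v cv; apply: closureS => _ [x _ <-] /=.
    exists (- (f x - q (f x))).
      by rewrite -scaleN1r; have [_ _] := ker_linear hk; apply; exact: hq.
    by exists (f x); [exists x|rewrite opprB subrK].
  have kv : range k v.
    apply: ck; apply: closureS cv => _ [y _ <-] /=.
    by have [] := qP (f y).
  exists x => //=; apply/eqP; rewrite eq_sym -subr_eq0; apply/eqP/ip_eq0.
  have [z _ zE] : range k (v - q (f x)).
    by apply: linear_setB (range_linear kh) _ _ => //; have [] := qP (f x).
  rewrite -{1}zE khP -av -addrA (adj_pairD hk) ha add0r.
  by rewrite hq ip0r.
split=> //; last first.
  apply: orth_meet0; exists 0; first exact: (adj_pair0 hk).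
  by exists 0; [exists 0; rewrite // (adj_pair0 fg)|rewrite addr0].
apply/seteqP; split=> // y _.
(* Write [y = q (f x) + u] with [g (q u) = 0]. The part [q u] is orthogonal to [ker h], being in the
   range of [k], and to the range of [f]; the rest lies in the sum. *)
have [_ [x _ <-] /= gqu] := range_ker_decomp (adj_pair_comp fg qq) cqf y.
set u := y - q (f x) in gqu.
exists ((u - q u) + q (f x)).
  exists ((u - q u) - (f x - q (f x))).
    by apply: linear_setB (ker_linear hk) _ _; exact: hq.
  by exists (f x); [exists x|rewrite opprB addrA subrK addrC addrA].
exists (q u); last by rewrite addrAC subrK /u subrK.
move=> _ [a ha [_ [z _ <-] <-]]; rewrite ipDl fgP gqu ip0r addr0.
move: ha; rewrite (ker_orth_range hk) => ha; apply: ip_eq0C.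
by apply: ha; have [] := qP u.
Qed.

End Composition.

(** Scaling to unit vectors; the supremum is a true upper bound because 4 bounds its set. *)
Lemma c0_bound (F : hilbertModType A) (M N : set F) :
  linear_set M -> linear_set N ->
  forall x y, M x -> N y -> nrm (ip x y) <= c0 M N * nrm x * nrm y.
Proof.
move=> [_ _ MZ] [_ _ NZ].
have unit_bound x y : M x -> nrm x <= 1 -> N y -> nrm y <= 1 -> nrm (ip x y) <= c0 M N.
  move=> Mx x1 Ny y1; apply: ub_le_sup; last first.
    by exists x, y; split=> //; rewrite nrmE lecR.
  exists 4 => _ [u [v [_ u1 _ v1 ->]]].
  by apply: nrm_ip_le4; rewrite -lecR -nrmE.
move=> x y Mx Ny.
have [x0|/eqP x0] := eqVneq x 0; first by rewrite x0 ip0l !nrm0 mulr0 mul0r.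
have [y0|/eqP y0] := eqVneq y 0; first by rewrite y0 ip0r !nrm0 mulr0.
have {}x0 := nrm_gt0 x0; have {}y0 := nrm_gt0 y0.
have := unit_bound ((nrm x)^-1%:C%C *: x) ((nrm y)^-1%:C%C *: y).
rewrite !nrmZ ?invr_ge0 ?nrm_ge0// !mulVf ?gt_eqF//.
move=> /(_ (MZ _ _ Mx) (lexx _) (NZ _ _ Ny) (lexx _)).
rewrite ipZl ipZr conj_Creal ?complex_real// !nrmZ ?invr_ge0 ?nrm_ge0//.
rewrite ler_pdivrMl// ler_pdivrMl// => /le_trans; apply.
by rewrite le_eqVlt; apply/orP; left; apply/eqP; ring.
Qed.

(** For [a] in [N] and [y] in the range, [(1 - c) |a| <= |a - p a| = |(a + y) - p (a + y)| <= |a +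
    y|]. Hence the components of a convergent sequence of sums converge separately. *)
Lemma c0_closed_sumset (E F : hilbertModType A) (f : E -> F) (g : F -> E) (N : set F) :
  adj_pair f g -> closed (range f) -> closed N -> linear_set N ->
  c0 (range f) N < 1 -> closed (sumset N (range f)).
Proof.
move=> fg cf cN lN; have lf := range_linear fg.
move=> c1; pose c := Num.max (c0 (range f) N) 0.
have c0' : 0 <= c by rewrite le_max lexx orbT.
have {}c1 : 0 < 1 - c by rewrite subr_gt0 gt_max c1 ltr01.
have cP x y : range f x -> N y -> nrm (ip x y) <= c * nrm x * nrm y.
  move=> fx Ny; apply: le_trans (c0_bound lf lN fx Ny) _.
  by rewrite !ler_wpM2r ?nrm_ge0// le_max lexx.
have [p pp pP] : exists2 p : F -> F, adj_pair p p & forall x,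
    [/\ range f (p x), orth (range f) (x - p x) & nrm (x - p x) <= nrm x].
  apply: exists_proj => x; have [y fy gy] := range_ker_decomp fg cf x.
  by exists y => //; rewrite -(ker_orth_range (adj_pairC fg)).
have angle y : N y -> (1 - c) * nrm y <= nrm (y - p y).
  move=> Ny; have [fp op _] := pP y.
  have py : nrm (p y) <= c * nrm y.
    apply: le_of_sqr_le; rewrite ?mulr_ge0 ?nrm_ge0// -nrm_ip.
    have -> : ip (p y) (p y) = ip (p y) y.
      by apply/esym/eqP; rewrite -subr_eq0 -ipBr; apply/eqP; exact: op.
    by rewrite mulrCA mulrA; exact: cP.
  by have := nrmD (y - p y) (p y); rewrite subrK; lra.
have p_id y : range f y -> p y = y.
  move=> fy; have [fp op _] := pP y.
  apply/eqP; rewrite eq_sym -subr_eq0; apply/eqP/ip_eq0/op.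
  exact: linear_setB lf fy fp.
have proj_le a y : N a -> range f y -> (1 - c) * nrm a <= nrm (a + y).
  move=> Na fy; apply: le_trans (angle _ Na) _.
  have -> : a - p a = (a + y) - p (a + y).
    by rewrite (adj_pairD pp) (p_id _ fy) opprD addrACA subrr addr0.
  by have [_ _] := pP (a + y).
move=> l /closureP cl.
have half01 : 0 < (2^-1 : R) < 1 by lra.
have h0 n : 0 < (2^-1 : R) ^+ n by rewrite exprn_gt0//; lra.
have /choice[w wP] : forall n, exists w : F * F,
    [/\ N w.1, range f w.2 & nrm (w.1 + w.2 - l) < 2^-1 ^+ n].
  by move=> n; have [_ [a Na [y fy <-]] ayl] := cl _ (h0 n); exists (a, y).
pose a n := (w n).1; pose y n := (w n).2.
have Na n : N (a n) by have [] := wP n.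
have fy n : range f (y n) by have [] := wP n.
have wl n : nrm (a n + y n - l) <= 2^-1 ^+ n by have [_ _ /ltW] := wP n.
(* The errors [2^-n] and [2^-(n+1)] sum to less than [2 * 2^-n]; [proj_le] costs the factor
   [1 / (1 - c)]. *)
have a_dist n : nrm (a n.+1 - a n) <= (2 / (1 - c)) * 2^-1 ^+ n.
  rewrite mulrAC ler_pdivlMr// mulrC.
  apply: le_trans (proj_le _ (y n.+1 - y n) _ _) _.
  - exact: linear_setB.
  - exact: linear_setB.
  rewrite addrACA -opprD; apply: le_trans (nrm_distD l _ _) _.
  rewrite [X in _ + X]nrm_distC.
  by have := wl n; have := wl n.+1; rewrite exprS; have := h0 n; lra.
have [b bP] := geometric_cvg half01 a_dist.
have C0 : 0 <= 2 / (1 - c) by rewrite divr_ge0// ltW.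
move: (2 / (1 - c)) => C in bP C0 {a_dist}.
have bC n : nrm (b - a n) <= 2 * C * 2^-1 ^+ n.
  apply: le_trans (bP n) _; have -> : (1 - 2^-1 : R)^-1 = 2 by field.
  by rewrite le_eqVlt; apply/orP; left; apply/eqP; ring.
have small e : 0 < e -> exists n, (2 * C + 1) * 2^-1 ^+ n < e.
  by apply: expr_small => //; lra.
have Nb : N b.
  move/closedP: cN; apply=> e /small[n ne]; exists (a n) => //.
  rewrite nrm_distC; apply: le_lt_trans (bC n) _; apply: le_lt_trans ne.
  by have := h0 n; nra.
have fb : range f (l - b).
  move/closedP: cf; apply=> e /small[n ne]; exists (y n) => //.
  have -> : y n - (l - b) = (a n + y n - l) + (b - a n).
    rewrite opprB [RHS]addrACA -opprD [l + a n]addrC opprD !addrA.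
    by rewrite [a n + y n]addrC [y n + a n + b]addrAC addrK.
  apply: le_lt_trans (nrmD _ _) _; apply: le_lt_trans ne.
  by have := wl n; have := bC n; lra.
by exists b => //; exists (l - b); rewrite // addrC subrK.
Qed.

(** The given bound is a complex number; its modulus serves as the real one. *)
Lemma adjointable_adj_pair (E F : hilbertModType A) (S : adjointable E F) :
  adj_pair S (adj S).
Proof.
split; first exact: adjP.
have [k kS] := op_bounded S.
have kE : `|k| = (complex.Re `|k|)%:C%C by rewrite RRe_real// normr_real.
exists (complex.Re `|k|); first by rewrite -lecR -kE normr_ge0.
move=> x; rewrite -lecR rmorphM/= -kE -!nrmE -[`|x|]normr_id -normrM.
by rewrite ger0_norm//; apply: le_trans (kS x).
Qed.

End Summands.

Theorem theorem3p9 (R : realType) (A : cStarAlgType R)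
    (E F G : hilbertModType A) (S : adjointable E F) (T : adjointable F G)
    (clS : closed (range S)) (clT : closed (range T)) :
  [/\ closed (range (T \o S)) <->
        orthogonal_summand (sumset (ker T) (range S)),
      orthogonal_summand (sumset (ker T) (range S)) <->
        orthogonal_summand (sumset (ker (adj S)) (range (adj T))) &
      c0 (range S) (ker T `&` orth (ker T `&` range S)) < 1 ->
      orthogonal_summand (closure (sumset (ker (adj S)) (range (adj T)))) ->
      closed (range (T \o S))].
Proof.
have SP := adjointable_adj_pair S; have TP := adjointable_adj_pair T.
have S'P := adj_pairC SP; have T'P := adj_pairC TP.
have cS' := adj_range_closed SP clS; have cT' := adj_range_closed TP clT.
have TSP := adj_pair_comp SP TP; have TS'P := adj_pairC TSP.
have summandE : closed (range (T \o S)) <->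
    orthogonal_summand (sumset (ker T) (range S)).
  split=> [/(closed_sumset_comp TP)|[]].
    exact: (sumset_orthogonal_summand SP TP).
  by move=> + _ _; exact: (closed_comp_sumset TP).
have summandE' : closed (range (T \o S)) <->
    orthogonal_summand (sumset (ker (adj S)) (range (adj T))).
  (* The range of [(TS)* = S* T*] is closed exactly when that of [TS] is. *)
  split=> [/(adj_range_closed TSP)/(closed_sumset_comp S'P)|[+ _ _]].
    exact: (sumset_orthogonal_summand T'P S'P).
  by move=> /(closed_comp_sumset S'P cS')/(adj_range_closed TS'P).
split; first exact: summandE.
  by rewrite -summandE.
move=> angle [cW sumW _]; apply: (closed_comp_sumset TP clT).
set K := ker T `&` range S in angle *; set N := ker T `&` orth K in angle *.
set W := sumset (ker (adj S)) (range (adj T)) in cW sumW.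
have KW x : K x -> orth (closure W) x.
  move=> [Tx [z _ zx]] y; apply: ip_closure y => _ [u Su [_ [v _ <-] <-]].
  have [S'x _] := S'P; have [T'x _] := T'P.
  move: Tx Su; rewrite /ker/= => Tx Su.
  by rewrite ipDl T'x Tx ip0r addr0 -zx -S'x Su ip0l.
have orthW x : orth (closure W) x -> K x.
  move=> Wx; have {}Wx y : W y -> ip y x = 0 by move=> /subset_closure; exact: Wx.
  split.
    rewrite (ker_orth_range TP) => y [z _ <-].
    apply: Wx; exists 0; first exact: (adj_pair0 S'P).
    by exists (adj T z); [exists z|rewrite add0r].
  (* [x - y] lies in [ker (adj S)], so it is orthogonal to [y] in the range of [S], and to [x]
     because [W] contains that kernel. *)
  have [y Sy S'y] := range_ker_decomp SP clS x.
  suff -> : x = y by [].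
  apply/eqP; rewrite -subr_eq0; apply/eqP/ip_eq0.
  rewrite ipBr Wx; last first.
    by exists (x - y) => //; exists 0; [exists 0; rewrite // (adj_pair0 T'P)|rewrite addr0].
  have : ker (adj S) (x - y) by [].
  rewrite (ker_orth_range S'P) => Oxy.
  by rewrite (ip_eq0C (Oxy _ Sy)) subr0.
have lN : linear_set N.
  by apply: linear_setI; [exact: ker_linear TP|exact: orth_linear].
have cN : closed N.
  by apply: closedI; [exact: ker_closed TP|exact: closed_orth].
have csum := c0_closed_sumset SP clS cN lN angle.
suff -> : sumset (ker T) (range S) = sumset N (range S) by [].
apply/seteqP; split=> _ [x Tx [_ [z _ <-] <-]]; last first.
  by exists x; [case: Tx|exists (S z); [exists z|]].
(* The component [b] lies in [K], hence in the range of [S], and is absorbed there; [a] stays in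
   [ker T] and is orthogonal to [K]. *)
have [a ca [b Ob ab]] : sumset (closure W) (orth (closure W)) x by rewrite sumW.
have Kb := orthW _ Ob; have [Tb Sb] := Kb.
exists a.
  split=> [|y Ky]; last by apply: ip_eq0C; exact: (KW _ Ky).
  have -> : a = x - b by rewrite -ab addrK.
  exact: linear_setB (ker_linear TP) Tx Tb.
exists (b + S z); last by rewrite addrA ab.
by have [_ SD _] := range_linear SP; apply: SD => //; exists z.
Qed.
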